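(* There exists $C_1>0$ such that for every $n$ large enough and every $j\in\{\lfloor\log n\rfloor,\dots,m\}$, $$\lambda_{n,j}=A_0(\sigma_{n,j})+\frac{A_1(\sigma_{n,j})}{n+\frac32}+\frac{A_2(\sigma_{n,j})}{\left(n+\frac32\right)^2}+R_{1,n,j},\qquad\text{where}\qquad |R_{1,n,j}|\le\frac{C_1}{\left(n+\frac32\right)^3}.$$
   Context: $a(t)=t^{-1}+t^2$, and $T_n(a)$ is the $n\times n$ Toeplitz matrix whose $(j,k)$ entry is $1$ if $k=j+1$ or $k=j-2$, and $0$ otherwise. For $n\ge3$ write $n=3m+r$ with $m\in\mathbb{N}$, $r\in\{0,1,2\}$. $L=3/\sqrt[3]{4}$. $T_n(a)$ has exactly $m$ eigenvalues in $(0,L)$, all simple, denoted $0<\lambda_{n,1}<\dots<\lambda_{n,m}<L$. $\log$ is the natural logarithm. Define $G\colon[0,1/3]\to[0,L]$ and $\vartheta\colon[0,1/3]\to\mathbb{R}$ by $$G(\alpha)=\frac{L\left(1-\frac13\tan^2(\frac\pi3-\pi\alpha)\right)}{\left(1+\tan^2(\frac\pi3-\pi\alpha)\right)^{2/3}},\qquad \vartheta(\alpha)=\frac16-\frac\alpha2-\frac1\pi\arctan\frac{\tan(\frac\pi3-\pi\alpha)}{3}.$$ Define functions on $[0,1/3]$ by $A_0=G$, $A_1=-G'\vartheta$, $A_2=G'\vartheta\vartheta'+\frac12G''\vartheta^2$. For $j\in\{1,\dots,m\}$ put $\sigma_{n,j}=\dfrac{j-\frac12+\frac r3}{n+\frac32}$.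 *)

(* Defs.v *)
From mathcomp Require Import all_boot all_order all_algebra.
From mathcomp Require Import all_classical all_reals all_analysis.
From mathcomp Require Import polyrcf.

Set Implicit Arguments.
Unset Strict Implicit.
Unset Printing Implicit Defensive.

Import Order.TTheory GRing.Theory Num.Theory.
Import numFieldNormedType.Exports.

Local Open Scope ring_scope.

(* Indices start at 0 instead of 1; the bands depend only on k - j. *)
Definition toepT (R : realType) (n : nat) : 'M[R]_n :=
  \matrix_(j < n, k < n) ((k == j + 1 :> nat)%N || (j == k + 2 :> nat)%N)%:R.

Definition Lmax (R : realType) : R := 3 / (4 `^ (3^-1)).

(* The strictly increasing list of the eigenvalues lying in ]0, L[; see
   [mem_eigs] and [sorted_eigs]. *)
Definition eigs (R : realType) (n : nat) : seq R :=
  roots (char_poly (toepT R n)) 0 (Lmax R).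

Lemma mem_eigs (R : realType) (n : nat) (x : R) :
  (x \in eigs R n) = eigenvalue (toepT R n) x && (0 < x < Lmax R).
Proof.
have p0 : char_poly (toepT R n) != 0 by rewrite monic_neq0 ?char_poly_monic.
by rewrite /eigs in_roots p0 andbT eigenvalue_root_char in_itv.
Qed.

Lemma sorted_eigs (R : realType) (n : nat) : sorted <%R (eigs R n).
Proof. exact: sorted_roots. Qed.

(* lambda_{n,j}, with j counted from 1. *)
Definition lambda (R : realType) (n j : nat) : R := (eigs R n)`_(j.-1).

(* G and vartheta are given by their formulas on all of R.  The formulas are
   smooth on ]-1/6, 5/6[, so on [0, 1/3] the derivatives below agree with those
   (one-sided at the endpoints) of the restrictions to [0, 1/3]. *)
Definition G (R : realType) (alpha : R) : R :=
  Lmax R * (1 - 3^-1 * tan (pi / 3 - pi * alpha) ^+ 2)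
    / ((1 + tan (pi / 3 - pi * alpha) ^+ 2) `^ (2 / 3)).

Definition vartheta (R : realType) (alpha : R) : R :=
  6^-1 - alpha / 2 - pi^-1 * atan (tan (pi / 3 - pi * alpha) / 3).

Definition A0 (R : realType) (alpha : R) : R := G alpha.

Definition A1 (R : realType) (alpha : R) : R :=
  - derive1 (@G R) alpha * vartheta alpha.

Definition A2 (R : realType) (alpha : R) : R :=
  derive1 (@G R) alpha * vartheta alpha * derive1 (@vartheta R) alpha
  + 2^-1 * derive1n 2 (@G R) alpha * vartheta alpha ^+ 2.

(* sigma_{n,j}, with r = n %% 3. *)
Definition sigma (R : realType) (n j : nat) : R :=
  (j%:R - 2^-1 + (n %% 3)%:R / 3) / (n%:R + 3 / 2).

(* Main.v *)
(* Parametrise ]0, L[ by lambda = G x, with f = pi/3 - pi x in ]0, pi/3[.  Then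
   two of the roots of z^3 = lambda z^2 - 1 are rho e^(+-i f) with
   rho^3 = 2 cos f, the third is -rho^(-2), and the characteristic polynomial of
   T_n at G x is a positive multiple of
     2 sin ((n+2) f) + sin (n f) + sin (2 f) (-1)^n / (2 cos f)^(n+2),
   that is, of sin (pi (N/3 - N x - vartheta x)) + e with N = n + 3/2 and
   |e| <= (2 cos f)^(-n-2) <= exp (-2 N x).  Between consecutive points where
   this sine is +-1 there is a root, which yields floor(n/3) eigenvalues in
   ]0, L[; there are no more, because the characteristic polynomial is
   lambda^r P(lambda^3) with deg P = floor(n/3).  Hence lambda_{n,j} = G x with
   N x + vartheta x = N sigma + O(exp (-2 j)), where the error is O(n^(-2)) for
   j >= log n - 1, and a Taylor expansion of G and vartheta at sigma concludes. *)
Require Import Defs.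
From mathcomp Require Import all_boot all_order all_algebra.
From mathcomp Require Import all_classical all_reals all_analysis.
From mathcomp Require Import ring lra zify.
Set Implicit Arguments.
Unset Strict Implicit.
Import Order.TTheory GRing.Theory Num.Theory.
Import numFieldNormedType.Exports.
Local Open Scope classical_set_scope.
Local Open Scope ring_scope.

(** * Eigenvalues and the three-term recurrence *)

(* The characteristic polynomial of [toepT R n], evaluated at [x]. *)
Fixpoint chi {R : realType} (x : R) (n : nat) : R :=
  match n with
  | 0 => 1
  | 1 => x
  | 2 => x ^+ 2
  | ((n'.+1 as n1).+1 as n2).+1 => x * chi x n2 - chi x n'
  end.

Section Chi.
Variable R : realType.
Implicit Types (x : R) (n : nat).

Lemma chi3 x n : chi x n.+3 = x * chi x n.+2 - chi x n.
Proof. by []. Qed.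

(** With [chi] read as 0 at negative indices, a single recurrence covers the initial values too;
    this matches the truncated first equations for an eigenvector. *)
Lemma chiS x n :
  chi x n.+1 = x * chi x n - (if (1 < n)%N then chi x (n - 2) else 0).
Proof.
case: n => [|[|n]] /=; rewrite ?mulr1 ?subr0 ?expr2 //.
by rewrite subn2.
Qed.

Lemma sum_delta n (V : nat -> R) (a : nat) :
  \sum_(j < n) V j * (j == a :> nat)%:R = if (a < n)%N then V a else 0.
Proof.
case: ifPn => [an|]; last first.
  rewrite -leqNgt => na; apply: big1 => j _.
  by rewrite ltn_eqF ?mulr0// (leq_trans (ltn_ord j)).
rewrite (bigD1 (Ordinal an))//= eqxx mulr1 big1 ?addr0// => j.
by rewrite -val_eqE /= => /negPf ->; rewrite mulr0.
Qed.

(* Left eigenvectors, read backwards, solve the three-term recurrence. *)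
Lemma toepT_eigenvecP n x (w : nat -> R) :
  (\row_(i < n.+1) w (n - i)%N) *m toepT R n.+1
    = x *: (\row_(i < n.+1) w (n - i)%N) <->
  (forall l, (l <= n)%N -> (if (l < n)%N then w l.+1 else 0)
     + (if (1 < l)%N then w (l - 2)%N else 0) = x * w l).
Proof.
have E (k : 'I_n.+1) : ((\row_(i < n.+1) w (n - i)%N) *m toepT R n.+1) 0 k =
    (if (n - k < n)%N then w (n - k).+1 else 0)
     + (if (1 < n - k)%N then w (n - k - 2)%N else 0).
  rewrite mxE.
  under eq_bigr => j _.
    rewrite !mxE.
    (* The bands are disjoint, so the entry is a sum of two deltas. The guard [0 < k] is there
       because [k.-1] is 0 at [k = 0]. *)
    have -> : (((k == j + 1 :> nat)%N || (j == k + 2 :> nat)%N)%:R : R)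
      = (j == k + 2 :> nat)%N%:R + ((0 < k)%N && (j == k.-1 :> nat)%N)%:R.
      case: (val k) => [|k'] /=.
        by rewrite addn1 addr0.
      rewrite addn1 eqSS eq_sym; case: eqVneq => [->|_] /=; rewrite ?add0r ?addr0 ?orbF//.
      by rewrite ltn_eqF ?add0r// addn2; apply/ltnW/ltnW.
    rewrite mulrDr.
    over.
  rewrite big_split/= addrC; congr (_ + _).
    case: (ltnP 0 k) => k0 /=.
      rewrite (sum_delta _ (fun j => w (n - j)%N)).
      have kn : (k <= n)%N by rewrite -ltnS.
      rewrite ifT; last lia.
      by rewrite ifT; [congr (w _); lia|lia].
    rewrite big1; last by move=> j _; rewrite mulr0.
    by rewrite ifF//; apply/negbTE; rewrite -leqNgt; lia.
  rewrite (sum_delta _ (fun j => w (n - j)%N)).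
  rewrite -subnDA; do 2 case: ifPn => //; lia.
split=> [H l ln|H].
  have ln' : (n - l < n.+1)%N by rewrite ltnS leq_subr.
  have := congr1 (fun A : 'rV_n.+1 => A 0 (Ordinal ln')) H.
  by rewrite E !mxE /= subKn.
apply/rowP => k; rewrite E H ?leq_subr//.
by rewrite !mxE.
Qed.

(** The equations for [l < n] determine a left eigenvector from its last entry [w 0], as
    [w l = w 0 * chi x l]. The equation for [l = n] then says that [chi] vanishes at the size of the
    matrix. *)
Lemma eigenvalue_toepT n x : (0 < n)%N ->
  eigenvalue (toepT R n) x = (chi x n == 0).
Proof.
case: n => // n _; apply/eigenvalueP/eqP => [[v vT v0]|cx].
  pose w (l : nat) : R := v 0 (inord (n - l)).
  have vw : v = \row_(i < n.+1) w (n - i)%N.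
    apply/rowP => i; rewrite mxE /w subKn ?inord_val//.
    by rewrite -ltnS.
  move: vT; rewrite vw => /toepT_eigenvecP H.
  have wE l : (l <= n)%N -> w l = w 0%N * chi x l.
    elim/ltn_ind: l => -[|l] IH ln; first by rewrite mulr1.
    have := H l (ltnW ln); rewrite ln => /(canRL (addrK _)) ->.
    rewrite (IH l)//; last exact: ltnW.
    rewrite chiS; case: ifP => l1; last by ring.
    by rewrite (IH (l - 2)%N); [ring|lia|lia].
  have w0 : w 0%N != 0.
    apply: contra_neq v0 => w0; apply/rowP => i; rewrite vw !mxE wE ?leq_subr//.
    by rewrite w0 mul0r.
  apply: (mulfI w0); rewrite mulr0.
  have := H n (leqnn n); rewrite ltnn add0r (wE n)// chiS.
  case: ifP => n1.
    rewrite wE; last lia.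
    by move=> E; rewrite mulrBr E mulrCA subrr.
  by move=> E; rewrite subr0 mulrCA -E.
exists (\row_(i < n.+1) chi x (n - i)%N).
  apply/toepT_eigenvecP => l ln.
  have -> : (if (l < n)%N then chi x l.+1 else 0) = chi x l.+1.
    by case: ltnP => // nl; rewrite (_ : l = n) ?cx//; lia.
  by rewrite chiS subrK.
apply/negP => /eqP /rowP /(_ ord_max); rewrite !mxE subnn /= => /eqP.
by rewrite oner_eq0.
Qed.

(** In the recurrence, all exponents of [x] lie in one class modulo 3. *)
Lemma chi_pow n : exists P : {poly R},
  (size P <= (n %/ 3).+1)%N /\ P != 0 /\
  forall x, chi x n = x ^+ (n %% 3) * P.[x ^+ 3].
Proof.
(* The induction carries the exact size: the subtracted polynomial is then strictly smaller, so the
   leading term survives. *)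
suff [p [sp Ep]] : exists p : {poly R}, size p = (n %/ 3).+1 /\
    forall x, chi x n = x ^+ (n %% 3) * p.[x ^+ 3].
  by exists p; rewrite -size_poly_eq0 sp.
elim/ltn_ind: n => -[|[|[|n]]] IH.
1-3: by exists 1; rewrite size_poly1; split=> // x; rewrite !hornerE.
have [p [sp Ep]] := IH n.+2 (ltnSn _).
have [q [sq Eq]] := IH n (ltnW (ltnW (ltnSn _))).
(* If 3 divides [n], the new factor [x] completes the [x ^+ 2] of [chi x n.+2] to a cube, hence
   ['X]; otherwise it only raises the residue by one. *)
exists ((if (n %% 3 == 0)%N then 'X else 1) * p - q); split.
  have sXp : size ((if (n %% 3 == 0)%N then 'X else 1) * p) = (n.+3 %/ 3).+1.
    case: eqP => n3; last by rewrite mul1r sp; lia.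
    by rewrite mulrC size_mulX ?sp -?size_poly_eq0 ?sp//; lia.
  by rewrite size_polyDl ?sXp// size_polyN sq; lia.
move=> x; rewrite chi3 Ep Eq.
have -> : (n.+3 %% 3 = n %% 3)%N by lia.
have : (n %% 3 < 3)%N by rewrite ltn_mod.
case n3: (n %% 3)%N => [|[|[|//]]] _ /=.
- have -> : (n.+2 %% 3 = 2)%N by lia.
  by rewrite hornerD hornerN hornerM ?hornerX ?hornerC; ring.
- have -> : (n.+2 %% 3 = 0)%N by lia.
  by rewrite hornerD hornerN hornerM ?hornerX ?hornerC; ring.
- have -> : (n.+2 %% 3 = 1)%N by lia.
  by rewrite hornerD hornerN hornerM ?hornerX ?hornerC; ring.
Qed.

(** Positive eigenvalues have distinct cubes, and these cubes are roots of the polynomial of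
    [chi_pow]. *)
Lemma size_eigs n : (0 < n)%N -> (size (eigs R n) <= n %/ 3)%N.
Proof.
move=> n0; have [P [sP [P0 EP]]] := chi_pow n.
rewrite -ltnS; apply: leq_trans sP.
rewrite -(size_map (fun x => x ^+ 3)); apply: max_poly_roots => //.
  apply/allP => _ /mapP[x + ->]; rewrite mem_eigs eigenvalue_toepT// EP.
  rewrite mulf_eq0 => /andP[/orP[|//] /[swap] /andP[x0 _]].
  by rewrite expf_eq0 gt_eqF// andbF.
rewrite map_inj_in_uniq; first exact/lt_sorted_uniq/sorted_eigs.
move=> x y; rewrite !mem_eigs => /andP[_ /andP[x0 _]] /andP[_ /andP[y0 _]].
by apply: pexpIrn => //; rewrite nnegrE ltW.
Qed.

End Chi.

(** * Derivatives and Taylor bounds *)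

Section Derivation.
Variable R : realType.
Implicit Types (f g : R -> R) (x y a b k : R).

(* Folding [is_derive] keeps instance resolution from guessing derivatives. *)
Definition deriv_at f x a : Prop := is_derive x 1 f a.

Lemma deriv_at_eq f x a b : deriv_at f x a -> a = b -> deriv_at f x b.
Proof. by move=> + <-. Qed.

Lemma deriv_at_cst k x : deriv_at (fun=> k) x 0.
Proof. exact: is_derive_cst. Qed.

Lemma deriv_at_id x : deriv_at (fun y : R => y) x 1.
Proof. exact: is_derive_id. Qed.

Lemma deriv_at_add f g x a b : deriv_at f x a -> deriv_at g x b ->
  deriv_at (fun y => f y + g y) x (a + b).
Proof. by move=> Hf Hg; exact: is_deriveD. Qed.

Lemma deriv_at_opp f x a : deriv_at f x a ->
  deriv_at (fun y => - f y) x (- a).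
Proof. by move=> Hf; exact: is_deriveN. Qed.

Lemma deriv_at_mul f g x a b : deriv_at f x a -> deriv_at g x b ->
  deriv_at (fun y => f y * g y) x (f x * b + g x * a).
Proof. by move=> Hf Hg; exact: is_deriveM. Qed.

Lemma deriv_at_exp f n x a : deriv_at f x a ->
  deriv_at (fun y => f y ^+ n) x (n%:R * f x ^+ n.-1 * a).
Proof.
move=> Hf; elim: n => [|n IH].
  by apply: deriv_at_eq; [exact: deriv_at_cst|rewrite !mul0r].
rewrite (_ : (fun y => _) = fun y => f y * f y ^+ n); last first.
  by apply/funext => y; rewrite exprS.
apply: deriv_at_eq; first exact: deriv_at_mul Hf IH.
by case: n {IH} => [|n]; rewrite ?mul0r /= ?exprS -?natr1; ring.
Qed.

Lemma deriv_at_inv f x a : f x != 0 -> deriv_at f x a ->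
  deriv_at (fun y => (f y)^-1) x (- a / f x ^+ 2).
Proof.
move=> f0 Hf; apply: (@deriv_at_eq _ _ (- f x ^- 2 * a)).
  exact: is_deriveV.
by rewrite !mulNr mulrC.
Qed.

Lemma deriv_at_comp f g x a b :
  deriv_at f (g x) a -> deriv_at g x b ->
  deriv_at (fun y => f (g y)) x (a * b).
Proof. by move=> Hf Hg; exact: is_derive1_comp. Qed.

End Derivation.

(** [base] is tried first and supplies the derivative of the non-polynomial ingredient. *)
Ltac deriv_with base := repeat first [exact base
  | apply: deriv_at_cst | apply: deriv_at_id | apply: deriv_at_add
  | apply: deriv_at_opp | apply: deriv_at_exp | apply: deriv_at_mul].

Ltac deriv := deriv_with deriv_at_cst.

(** * Mean value and Taylor inequalities *)

Section MeanValue.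
Variable R : realType.
Implicit Types (f : R -> R) (a b x y B M : R).

Lemma deriv_within_continuous f a b :
  (forall x, a <= x <= b -> exists d, deriv_at f x d) ->
  {within `[a, b], continuous f}.
Proof.
move=> df; apply: derivable_within_continuous => x; rewrite in_itv/= => xab.
by have [d []] := df x xab.
Qed.

Lemma mean_value f f' a b : a < b ->
  (forall x, a <= x <= b -> deriv_at f x (f' x)) ->
  exists2 c, a < c < b & f b - f a = f' c * (b - a).
Proof.
move=> ab df; have [x||c cab E] := @MVT _ f f' _ _ ab.
- by rewrite in_itv/= => /andP[ax xb]; apply: df; rewrite !ltW.
- by apply: deriv_within_continuous => x xab; exists (f' x); exact: df.
- by exists c => //; move: cab; rewrite in_itv.
Qed.

Lemma deriv_gt0_incr f f' a b :
  (forall x, a <= x <= b -> deriv_at f x (f' x)) ->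
  (forall x, a < x < b -> 0 < f' x) ->
  forall x y, a <= x -> x < y -> y <= b -> f x < f y.
Proof.
move=> df f0 x y ax xy yb.
have [z /andP[xz zy]|c /andP[xc cy] E] := @mean_value f f' _ _ xy.
  by apply: df; rewrite (le_trans ax)// (le_trans zy).
rewrite -subr_gt0 E mulr_gt0 ?subr_gt0// f0//.
by rewrite (le_lt_trans ax)// (lt_le_trans cy).
Qed.

Lemma deriv_bound_lip f f' a b B :
  (forall x, a <= x <= b -> deriv_at f x (f' x)) ->
  (forall x, a <= x <= b -> `|f' x| <= B) ->
  forall x y, a <= x <= b -> a <= y <= b -> `|f y - f x| <= B * `|y - x|.
Proof.
move=> df Bf x y; wlog xy : x y / x < y.
  move=> H xab yab; case: (ltgtP x y) => [/H|yx|->]; first exact.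
    by rewrite distrC (distrC y) H.
  by rewrite !subrr normr0 mulr0.
move=> /andP[ax xb] /andP[ay yb].
have [z /andP[xz zy]|c /andP[xc cy] ->] := @mean_value f f' _ _ xy.
  by apply: df; rewrite (le_trans ax)// (le_trans zy).
by rewrite normrM ler_wpM2r// Bf// (le_trans ax (ltW xc))// (le_trans (ltW cy)).
Qed.

(** Concavity: a negative value inside would force a negative slope before it and a positive slope
    after it. *)
Lemma nonincr_deriv_ge0 f f' a b :
  (forall x, a <= x <= b -> deriv_at f x (f' x)) ->
  (forall x y, a <= x -> x <= y -> y <= b -> f' y <= f' x) ->
  0 <= f a -> 0 <= f b -> forall x, a <= x <= b -> 0 <= f x.
Proof.
move=> df mf fa fb x /andP[ax xb]; rewrite leNgt; apply/negP => fx.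
have {}ax : a < x.
  by rewrite lt_neqAle ax andbT; apply: contraTneq fx => <-; rewrite -leNgt.
have {}xb : x < b.
  by rewrite lt_neqAle xb andbT; apply: contraTneq fx => ->; rewrite -leNgt.
have [z /andP[az zx]|c /andP[ac cx] E1] := @mean_value f f' _ _ ax.
  by apply: df; rewrite az (le_trans zx)// ltW.
have [z /andP[xz zb]|d /andP[xd db] E2] := @mean_value f f' _ _ xb.
  by apply: df; rewrite zb (le_trans (ltW ax)).
have cd : f' d <= f' c by apply: mf; rewrite ltW// (lt_trans cx).
have xa0 : 0 < x - a by rewrite subr_gt0.
have bx0 : 0 < b - x by rewrite subr_gt0.
have c0 : f' c < 0 by rewrite -(pmulr_llt0 _ xa0) -E1; lra.
have d0 : 0 < f' d by rewrite -(pmulr_lgt0 _ bx0) -E2; lra.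
lra.
Qed.

(** Restricting to the segment between [x] and [y] lets a derivative bound in terms of [|y - x|]
    enter [deriv_bound_lip], whichever point is the larger. *)
Lemma segment_between a b x y : a <= x <= b -> a <= y <= b ->
  exists lo hi, [/\ lo <= x <= hi, lo <= y <= hi,
    forall z, lo <= z <= hi -> a <= z <= b &
    forall z, lo <= z <= hi -> `|z - x| <= `|y - x|].
Proof.
move=> /andP[ax xb] /andP[ay yb].
exists (Num.min x y), (Num.max x y); rewrite !ge_min !le_max !lexx !orbT.
split=> // z; case: (leP x y) => xy /andP[h1 h2].
- by apply/andP; split; lra.
- by apply/andP; split; lra.
- by rewrite !ger0_norm; lra.
- by rewrite !ler0_norm; lra.
Qed.

(** As a function of [y], the remainder has derivative [f1 y - f1 x], which is at most [M |y - x|];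
    the mean value inequality gives [M] as constant. *)
Lemma taylor1 f f1 f2 a b M :
  (forall x, a <= x <= b -> deriv_at f x (f1 x)) ->
  (forall x, a <= x <= b -> deriv_at f1 x (f2 x)) ->
  (forall x, a <= x <= b -> `|f2 x| <= M) ->
  forall x y, a <= x <= b -> a <= y <= b ->
  `|f y - f x - f1 x * (y - x)| <= M * `|y - x| ^+ 2.
Proof.
move=> df df1 Mf x y xab yab.
have [lo [hi [xl yl sub dist]]] := segment_between xab yab.
have M0 : 0 <= M := le_trans (normr_ge0 _) (Mf x xab).
pose h z := f z + - f1 x * (z + - x).
have dh z : lo <= z <= hi -> deriv_at h z (f1 z - f1 x).
  move=> zl; apply: deriv_at_eq.
    by apply: deriv_at_add; [exact: df (sub z zl)|apply: deriv_at_mul; deriv].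
  by rewrite /=; ring.
have Bh z : lo <= z <= hi -> `|f1 z - f1 x| <= M * `|y - x|.
  move=> zl; apply: le_trans (deriv_bound_lip df1 Mf xab (sub z zl)) _.
  by rewrite ler_wpM2l// dist.
have := deriv_bound_lip dh Bh xl yl.
by rewrite /h subrr mulr0 addr0 mulNr addrAC -mulrA -expr2.
Qed.

(** Same argument one order higher: [taylor1] for [f1] bounds the derivative of the remainder. *)
Lemma taylor2 f f1 f2 f3 a b M :
  (forall x, a <= x <= b -> deriv_at f x (f1 x)) ->
  (forall x, a <= x <= b -> deriv_at f1 x (f2 x)) ->
  (forall x, a <= x <= b -> deriv_at f2 x (f3 x)) ->
  (forall x, a <= x <= b -> `|f3 x| <= M) ->
  forall x y, a <= x <= b -> a <= y <= b ->
  `|f y - f x - f1 x * (y - x) - 2^-1 * f2 x * (y - x) ^+ 2|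
    <= M * `|y - x| ^+ 3.
Proof.
move=> df df1 df2 Mf x y xab yab.
have [lo [hi [xl yl sub dist]]] := segment_between xab yab.
have M0 : 0 <= M := le_trans (normr_ge0 _) (Mf x xab).
pose h z := f z + - f1 x * (z + - x) + - (2^-1 * f2 x) * (z + - x) ^+ 2.
have dh z : lo <= z <= hi ->
    deriv_at h z (f1 z - f1 x - f2 x * (z - x)).
  move=> zl; apply: deriv_at_eq.
    apply: deriv_at_add; first by apply: deriv_at_add;
      [exact: df (sub z zl)|apply: deriv_at_mul; deriv].
    by apply: deriv_at_mul; deriv.
  by rewrite /=; field.
have Bh z : lo <= z <= hi ->
    `|f1 z - f1 x - f2 x * (z - x)| <= M * `|y - x| ^+ 2.
  move=> zl; apply: le_trans (taylor1 df1 df2 Mf xab (sub z zl)) _.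
  by rewrite ler_wpM2l// lerXn2r ?nnegrE// dist.
have := deriv_bound_lip dh Bh xl yl.
rewrite -mulrA -exprSr; congr (`|_| <= _).
by rewrite /h; ring.
Qed.

End MeanValue.

(** * The functions G and vartheta *)

Section Angle.
Variable R : realType.
Implicit Types (x y : R).

(** The angles pi/3 and 2 pi/3 have the same sine, so the duplication formula gives [2 cos = 1]. *)
Lemma cos_pi3 : cos (pi / 3) = 2^-1 :> R.
Proof.
have p0 := @pi_gt0 R.
have s0 : 0 < sin (pi / 3 : R) by apply: sin_gt0_pi; apply/andP; split; lra.
have : sin (pi / 3 *+ 2) = sin (pi / 3) :> R.
  have -> : pi / 3 *+ 2 = - (pi / 3 - pi) :> R by rewrite mulr2n; field.
  by rewrite sinN -[in RHS](subrK pi (pi / 3)) sinDpi.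
rewrite sin_mulr2n => E; apply: (mulIf (lt0r_neq0 s0)).
by move: E; rewrite mulr2n; lra.
Qed.

Lemma sin_pi3_sqr : sin (pi / 3) ^+ 2 = 3 / 4 :> R.
Proof. by rewrite sin2cos2 cos_pi3; field. Qed.

Definition phi x : R := pi / 3 - pi * x.
Definition tphi x : R := tan (phi x).

Lemma phi_itv x : 0 <= x <= 3^-1 -> 0 <= phi x <= pi / 3.
Proof.
have p0 := @pi_gt0 R; move=> /andP[x0 x1]; rewrite /phi; apply/andP; split.
  by rewrite -mulrBr mulr_ge0 ?(ltW p0)//; lra.
by rewrite gerBl mulr_ge0// ltW.
Qed.

Lemma cos_phi_ge x : 0 <= x <= 3^-1 -> 2^-1 <= cos (phi x).
Proof.
have p0 := @pi_gt0 R.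
move=> /phi_itv /andP[h0 h1]; rewrite -cos_pi3 leNgt ltr_cos -?leNgt//.
  by rewrite in_itv/=; apply/andP; split; lra.
by rewrite in_itv/=; apply/andP; split; lra.
Qed.

Lemma cos_phi_gt0 x : 0 <= x <= 3^-1 -> 0 < cos (phi x).
Proof. by move=> /cos_phi_ge; apply: lt_le_trans; lra. Qed.

Lemma sin_phi_ge0 x : 0 <= x <= 3^-1 -> 0 <= sin (phi x).
Proof.
have p0 := @pi_gt0 R.
by move=> /phi_itv /andP[h0 h1]; apply: sin_ge0_pi; apply/andP; split; lra.
Qed.

Lemma sin_phi_gt0 x : 0 < x < 3^-1 -> 0 < sin (phi x).
Proof.
have p0 := @pi_gt0 R; move=> /andP[x0 x1]; apply: sin_gt0_pi; rewrite /phi.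
rewrite -mulrBr mulr_gt0//=; last lra.
by rewrite gtr_pMr//; lra.
Qed.

Lemma tphi_ge0 x : 0 <= x <= 3^-1 -> 0 <= tphi x.
Proof. by move=> xI; rewrite divr_ge0 ?sin_phi_ge0// ltW// cos_phi_gt0. Qed.

Lemma tphi_gt0 x : 0 < x < 3^-1 -> 0 < tphi x.
Proof.
move=> xI; rewrite divr_gt0 ?sin_phi_gt0// cos_phi_gt0//.
by case/andP: xI => ? ?; rewrite !ltW.
Qed.

Lemma tphi_sqr_le3 x : 0 <= x <= 3^-1 -> tphi x ^+ 2 <= 3.
Proof.
move=> xI; have c := cos_phi_ge xI.
have c0 := lt0r_neq0 (cos_phi_gt0 xI).
suff : cos (phi x) ^- 2 <= 4 by rewrite cos2_tan2// -/(tphi x); lra.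
rewrite -[4]invrK lef_pV2 ?posrE ?exprn_gt0 ?cos_phi_gt0// ?invr_gt0 //.
rewrite (_ : 4^-1 = 2^-1 ^+ 2 :> R); last by field.
by rewrite lerXn2r ?nnegrE ?invr_ge0// ltW// cos_phi_gt0.
Qed.

Lemma tphi_le2 x : 0 <= x <= 3^-1 -> tphi x <= 2.
Proof.
move=> xI; have := tphi_sqr_le3 xI; have := tphi_ge0 xI; nra.
Qed.

Lemma deriv_phi x : deriv_at phi x (- pi).
Proof. by apply: deriv_at_eq; [deriv|rewrite /=; ring]. Qed.

Lemma deriv_cos_phi x : deriv_at (fun y => cos (phi y)) x (pi * sin (phi x)).
Proof.
apply: deriv_at_eq; first apply: (deriv_at_comp _ (deriv_phi x)); first exact: is_derive_cos.
by ring.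
Qed.

Lemma deriv_sin_phi x : deriv_at (fun y => sin (phi y)) x (- pi * cos (phi x)).
Proof.
apply: deriv_at_eq; first apply: (deriv_at_comp _ (deriv_phi x)); first exact: is_derive_sin.
by ring.
Qed.

Lemma deriv_tphi x : cos (phi x) != 0 ->
  deriv_at tphi x (- pi * (1 + tphi x ^+ 2)).
Proof.
move=> c0.
apply: deriv_at_eq; first by apply: (deriv_at_comp _ (deriv_phi x)); exact: is_derive_tan.
by rewrite cos2_tan2// -/(tphi x); ring.
Qed.

(* [G] is a quadratic polynomial in [tphi] times [wphi], and
   [tphi' = - pi (1 + tphi^2)]: all derivatives of [G] keep this shape. *)
Definition wphi x : R := (1 + tphi x ^+ 2) `^ (- (2 / 3)).

Lemma deriv_wphi x : cos (phi x) != 0 ->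
  deriv_at wphi x (4 / 3 * pi * tphi x * wphi x).
Proof.
move=> c0; have t0 : 0 < 1 + tphi x ^+ 2 by rewrite ltr_pwDl// sqr_ge0.
have Dt : deriv_at (fun y => 1 + tphi y ^+ 2) x
    (- 2 * pi * tphi x * (1 + tphi x ^+ 2)).
  by apply: deriv_at_eq; [deriv_with (deriv_tphi c0)|rewrite /=; ring].
have Dp := is_derive1_powR (- (2 / 3)) t0.
apply: deriv_at_eq.
  exact: (deriv_at_comp (g := fun y => 1 + tphi y ^+ 2) Dp Dt).
(* Lowering the exponent by one divides [wphi] by [1 + tphi^2], which cancels against the derivative
   of [1 + tphi^2]. *)
rewrite /= powRB ?powRr1 ?(ltW t0) ?lt0r_neq0 ?implybT// -/(wphi x).
by field; rewrite lt0r_neq0.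
Qed.

Lemma wphi_gt0 x : 0 < wphi x.
Proof. by apply: powR_gt0; rewrite ltr_pwDl// sqr_ge0. Qed.

Lemma wphi_le1 x : wphi x <= 1.
Proof.
by rewrite /wphi -[leRHS](@powRr0 R (1 + tphi x ^+ 2)) ler_powR ?lerDl ?sqr_ge0.
Qed.

Definition G1 x : R := Lmax R * pi * wphi x * (2 * tphi x + 2 / 9 * tphi x ^+ 3).
Definition G2 x : R := - (Lmax R * pi ^+ 2) * wphi x * (2 + 10 / 27 * tphi x ^+ 4).
Definition G3 x : R := Lmax R * pi ^+ 3 * wphi x *
  (40 / 27 * tphi x ^+ 3 * (1 + tphi x ^+ 2)
   - 4 / 3 * tphi x * (2 + 10 / 27 * tphi x ^+ 4)).

Lemma G_wphi : @G R = fun x => Lmax R * (1 + - (3^-1 * tphi x ^+ 2)) * wphi x.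
Proof. by apply/funext => x; rewrite /wphi powRN. Qed.

Lemma deriv_G x : cos (phi x) != 0 -> deriv_at (@G R) x (G1 x).
Proof.
move=> c0; rewrite G_wphi; apply: deriv_at_eq.
  apply: (deriv_at_mul _ (deriv_wphi c0)); deriv_with (deriv_tphi c0).
by rewrite /G1 /=; field.
Qed.

Lemma deriv_G1 x : cos (phi x) != 0 -> deriv_at G1 x (G2 x).
Proof.
move=> c0; apply: deriv_at_eq.
  apply: deriv_at_mul; first by apply: (deriv_at_mul _ (deriv_wphi c0)); deriv.
  by deriv_with (deriv_tphi c0).
by rewrite /G2 /=; field.
Qed.

Lemma deriv_G2 x : cos (phi x) != 0 -> deriv_at G2 x (G3 x).
Proof.
move=> c0; apply: deriv_at_eq.
  apply: deriv_at_mul; first by apply: (deriv_at_mul _ (deriv_wphi c0)); deriv.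
  by deriv_with (deriv_tphi c0).
by rewrite /G3 /=; field.
Qed.

Definition vt1 x : R := - 2^-1 + 3 * (1 + tphi x ^+ 2) / (9 + tphi x ^+ 2).
Definition vt2 x : R :=
  - 48 * pi * tphi x * (1 + tphi x ^+ 2) / (9 + tphi x ^+ 2) ^+ 2.

Lemma tphi9_gt0 x : 0 < 9 + tphi x ^+ 2.
Proof. by rewrite ltr_pwDl// sqr_ge0. Qed.

Lemma deriv_vartheta x : cos (phi x) != 0 -> deriv_at (@vartheta R) x (vt1 x).
Proof.
move=> c0; have p0 := lt0r_neq0 (@pi_gt0 R); have t9 := lt0r_neq0 (tphi9_gt0 x).
apply: deriv_at_eq.
  apply: deriv_at_add; first by deriv.
  apply: deriv_at_opp; apply: deriv_at_mul; first by deriv.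
  apply: (@deriv_at_comp _ atan (fun y => tphi y / 3)).
    exact: is_derive1_atan.
  apply: deriv_at_mul; deriv_with (deriv_tphi c0).
rewrite /vt1 /=; move: p0; generalize (pi : R) => p p0.
by field; rewrite t9 p0.
Qed.

Lemma deriv_vt1 x : cos (phi x) != 0 -> deriv_at vt1 x (vt2 x).
Proof.
move=> c0; have t9 := lt0r_neq0 (tphi9_gt0 x).
apply: deriv_at_eq.
  apply: deriv_at_add; first by deriv.
  apply: deriv_at_mul; first by deriv_with (deriv_tphi c0).
  by apply: (@deriv_at_inv _ (fun y => 9 + tphi y ^+ 2) _ _ t9); deriv_with (deriv_tphi c0).
rewrite /vt2 /=; generalize (pi : R) => p; by field.
Qed.

End Angle.

(** * Endpoint values, derivatives and bounds on [0, 1/3] *)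

Section Values.
Variable R : realType.
Implicit Types (x y : R).

Lemma phi0 : phi (0 : R) = pi / 3.
Proof. by rewrite /phi mulr0 subr0. Qed.

Lemma phi13 : phi (3^-1 : R) = 0.
Proof. by rewrite /phi subrr. Qed.

Lemma tphi13 : tphi (3^-1 : R) = 0.
Proof. by rewrite /tphi phi13 tan0. Qed.

Lemma tphi0_sqr : tphi (0 : R) ^+ 2 = 3.
Proof.
by rewrite /tphi phi0 /tan expr_div_n sin_pi3_sqr cos_pi3; field.
Qed.

Lemma Lmax_gt0 : 0 < Lmax R.
Proof. by rewrite divr_gt0// powR_gt0. Qed.

Lemma G0 : G (0 : R) = 0.
Proof. by rewrite G_wphi tphi0_sqr mulVf ?subrr ?mulr0 ?mul0r. Qed.

Lemma G13 : G (3^-1 : R) = Lmax R.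
Proof.
by rewrite G_wphi /wphi tphi13 expr0n mulr0 subr0 addr0 powR1 !mulr1.
Qed.

Lemma vartheta13 : vartheta (3^-1 : R) = 0.
Proof.
rewrite /vartheta (_ : tan _ = 0); last exact: tphi13.
by rewrite mul0r atan0 mulr0 subr0; field.
Qed.

(** A third of tan (pi/3) is tan (pi/6), because pi/6 and pi/3 are complementary and tan (pi/3)
    squares to 3; the arctangent is thus pi/6. *)
Lemma vartheta0 : vartheta (0 : R) = 0.
Proof.
have p0 := @pi_gt0 R.
have s0 : 0 < sin (pi / 3 : R) by apply: sin_gt0_pihalf; apply/andP; split; lra.
have E : tan (pi / 3) / 3 = tan (pi / 6) :> R.
  have -> : pi / 6 = pi / 2 - pi / 3 :> R by field.
  rewrite [in RHS]/tan sinB cosB sin_pihalf cos_pihalf !mul0r !mul1r subr0 add0r.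
  rewrite /tan cos_pi3; have := sin_pi3_sqr R.
  set s := sin _ in s0 *; move=> s2; apply: (mulIf (lt0r_neq0 s0)).
  by rewrite divfK ?lt0r_neq0//; rewrite expr2 in s2; lra.
rewrite /vartheta mulr0 subr0 E tanK; last first.
  by rewrite in_itv/=; apply/andP; split; lra.
by move: p0; generalize (pi : R) => p p0; field; exact: lt0r_neq0.
Qed.

Lemma deriv_at_derive1 (f : R -> R) x a : deriv_at f x a -> derive1 f x = a.
Proof. by case=> _ <-; rewrite derive1E. Qed.

(** The second derivative of [G] at [x] needs the formula for the first one on a full neighbourhood
    of [x], even at the endpoints. *)
Lemma cos_phi_near x : 0 <= x <= 3^-1 -> \forall y \near x, cos (phi y) != 0.
Proof.
move=> xI; have cx : {for x, continuous (fun y : R => cos (phi y))}.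
  apply/differentiable_continuous/derivable1_diffP.
  by case: (deriv_cos_phi x).
near=> y; apply: lt0r_neq0; near: y.
exact: (cvgr_gt _ cx _ (cos_phi_gt0 xI)).
Unshelve. all: end_near. Qed.

Lemma derive1_G x : 0 <= x <= 3^-1 -> derive1 (@G R) x = G1 x.
Proof.
move=> xI; apply: deriv_at_derive1; apply: deriv_G.
exact/lt0r_neq0/cos_phi_gt0.
Qed.

Lemma derive1_vartheta x : 0 <= x <= 3^-1 -> derive1 (@vartheta R) x = vt1 x.
Proof.
move=> xI; apply: deriv_at_derive1; apply: deriv_vartheta.
exact/lt0r_neq0/cos_phi_gt0.
Qed.

Lemma derive1n2_G x : 0 <= x <= 3^-1 -> derive1n 2 (@G R) x = G2 x.
Proof.
move=> xI; rewrite derive1nS derive1n1 derive1E.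
rewrite (@near_eq_derive _ _ _ _ (@G1 R)).
- by rewrite -derive1E; apply/deriv_at_derive1/deriv_G1/lt0r_neq0/cos_phi_gt0.
- near=> y; apply/deriv_at_derive1/deriv_G.
  by near: y; exact: cos_phi_near.
Unshelve. all: end_near. Qed.

Lemma G_incr x y : 0 <= x -> x < y -> y <= 3^-1 -> G x < G y.
Proof.
apply: (@deriv_gt0_incr _ _ (@G1 R)) => z zI.
  exact/deriv_G/lt0r_neq0/cos_phi_gt0.
have t0 := tphi_gt0 zI.
rewrite /G1 !mulr_gt0 ?Lmax_gt0 ?pi_gt0 ?wphi_gt0//.
by rewrite addr_gt0// mulr_gt0// exprn_gt0.
Qed.

(** The quotient in [vt1] lies in [0, 1], its upper bound being equivalent to [tphi^2 <= 3]. *)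
Lemma vt1_bound x : 0 <= x <= 3^-1 -> `|vt1 x| <= 2^-1.
Proof.
move=> xI; have t3 := tphi_sqr_le3 xI; have t9 := tphi9_gt0 x.
have t0 := sqr_ge0 (tphi x).
have h1 : 3 * (1 + tphi x ^+ 2) / (9 + tphi x ^+ 2) <= 1.
  by rewrite ler_pdivrMr//; lra.
have h0 : 0 <= 3 * (1 + tphi x ^+ 2) / (9 + tphi x ^+ 2).
  by rewrite divr_ge0 ?(ltW t9)//; lra.
by rewrite /vt1 ler_norml; apply/andP; split; lra.
Qed.

Lemma vartheta_lip x y : 0 <= x <= 3^-1 -> 0 <= y <= 3^-1 ->
  `|vartheta y - vartheta x| <= 2^-1 * `|y - x|.
Proof.
apply: (@deriv_bound_lip _ _ (@vt1 R)) => z zI; last exact: vt1_bound.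
exact/deriv_vartheta/lt0r_neq0/cos_phi_gt0.
Qed.

Lemma vartheta_bound x : 0 <= x <= 3^-1 -> `|vartheta x| <= 1.
Proof.
move=> xI; have I0 : 0 <= (0 : R) <= 3^-1 by apply/andP; split; lra.
have := vartheta_lip I0 xI; rewrite vartheta0 !subr0 => /le_trans; apply.
by rewrite ger0_norm; case/andP: xI; lra.
Qed.

Lemma vt2_bound x : 0 <= x <= 3^-1 -> `|vt2 x| <= 48 * pi * 8.
Proof.
move=> xI; have t3 := tphi_sqr_le3 xI; have t0 := tphi_ge0 xI.
have t2 := tphi_le2 xI; have p0 := @pi_gt0 R; have t9 := tphi9_gt0 x.
have d0 : 0 < (9 + tphi x ^+ 2) ^+ 2 by rewrite exprn_gt0.
have -> : vt2 x =
    - (48 * pi * (tphi x * (1 + tphi x ^+ 2) / (9 + tphi x ^+ 2) ^+ 2)).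
  by rewrite /vt2 !mulrA !mulNr.
rewrite normrN ger0_norm; last first.
  apply: mulr_ge0; first by rewrite mulr_ge0// ltW.
  by rewrite divr_ge0 ?(ltW d0)// mulr_ge0// addr_ge0// sqr_ge0.
rewrite ler_pM2l ?mulr_gt0// ler_pdivrMr//.
have : 1 <= (9 + tphi x ^+ 2) ^+ 2 by nra.
nra.
Qed.

(** Each derivative is a constant times [wphi <= 1] times a polynomial in [tphi], which lies in
    [0, 2]; 100 is a crude bound for these polynomials. *)
Lemma G_bounds : exists2 M : R, 0 < M & forall x, 0 <= x <= 3^-1 ->
  [/\ `|G1 x| <= M, `|G2 x| <= M & `|G3 x| <= M].
Proof.
have p0 := @pi_gt0 R; have L0 := Lmax_gt0.
have aux (a b K : R) x : 0 < a -> `|b| <= K -> `|a * wphi x * b| <= a * K.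
  move=> a0 bK; rewrite !normrM (gtr0_norm a0) -mulrA ler_pM2l//.
  by rewrite gtr0_norm ?wphi_gt0// (le_trans _ bK)// ler_piMl// wphi_le1.
pose a := Lmax R * pi; pose b := Lmax R * pi ^+ 2; pose c := Lmax R * pi ^+ 3.
have a0 : 0 < a by rewrite mulr_gt0.
have b0 : 0 < b by rewrite mulr_gt0// exprn_gt0.
have c0 : 0 < c by rewrite mulr_gt0// exprn_gt0.
exists (a * 100 + b * 100 + c * 100); first by lra.
move=> x xI; have t0 := tphi_ge0 xI; have t2 := tphi_le2 xI.
have t3 : 0 <= tphi x ^+ 3 <= 8 by rewrite exprn_ge0//=; nra.
have t4 : 0 <= tphi x ^+ 4 <= 16 by rewrite exprn_ge0//=; nra.
have tt := tphi_sqr_le3 xI; have tt0 := sqr_ge0 (tphi x).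
split.
- apply: le_trans (aux _ _ 100 x a0 _) _; last lra.
  by rewrite ler_norml; apply/andP; split; lra.
- rewrite /G2 2!mulNr normrN; apply: le_trans (aux _ _ 100 x b0 _) _; last lra.
  by rewrite ler_norml; apply/andP; split; lra.
- apply: le_trans (aux _ _ 100 x c0 _) _; last lra.
  rewrite ler_norml; apply/andP; split; nra.
Qed.

(** * The modulus of the conjugate roots, and elementary inequalities *)

Definition rho x : R := (2 * cos (phi x)) `^ (3^-1).

Lemma rho_cube x : 0 <= x <= 3^-1 -> rho x ^+ 3 = 2 * cos (phi x).
Proof.
move=> xI; have c0 := cos_phi_gt0 xI.
by rewrite -powR_mulrn ?powR_ge0// -powRrM mulVf// powRr1// mulr_ge0// ltW.
Qed.

Lemma rho_gt0 x : 0 <= x <= 3^-1 -> 0 < rho x.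
Proof. by move=> xI; apply: powR_gt0; rewrite mulr_gt0// cos_phi_gt0. Qed.

(** This is the sum of the three roots of [z^3 = G z^2 - 1], namely [2 rho cos f - rho^(-2) = G],
    multiplied by [rho^2]. *)
Lemma G_rho x : 0 <= x <= 3^-1 -> G x * rho x ^+ 2 = 4 * cos (phi x) ^+ 2 - 1.
Proof.
move=> xI; have c0 := cos_phi_gt0 xI; have r0 := rho_gt0 xI.
set c := cos (phi x) in c0 *.
have cu : 1 + tphi x ^+ 2 = c ^- 2 by rewrite /tphi -cos2_tan2// lt0r_neq0.
set A : R := 4 `^ 3^-1; set B := (c ^- 2) `^ (2 / 3).
have A0 : 0 < A by exact: powR_gt0.
have B0 : 0 < B by rewrite powR_gt0// invr_gt0 exprn_gt0.
have A3 : A ^+ 3 = 4 by rewrite -powR_mulrn ?(ltW A0)// -powRrM mulVf// powRr1.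
have B3 : B ^+ 3 = c ^- 4.
  rewrite -powR_mulrn ?(ltW B0)// -powRrM divfK//.
  by rewrite powR_mulrn ?invr_ge0 ?sqr_ge0// -exprVn -exprVn -exprM.
(* Both sides are nonnegative, so it suffices to compare their cubes. *)
have E : rho x ^+ 2 = A * B * c ^+ 2.
  apply: (@pexpIrn _ 3) => //; rewrite ?nnegrE ?exprn_ge0 ?mulr_ge0 ?exprn_ge0 ?(ltW r0) ?(ltW A0) ?(ltW B0) ?(ltW c0)//.
  have -> : (rho x ^+ 2) ^+ 3 = (rho x ^+ 3) ^+ 2 by ring.
  have -> : (A * B * c ^+ 2) ^+ 3 = A ^+ 3 * B ^+ 3 * c ^+ 6 by ring.
  by rewrite A3 B3 rho_cube// -/c; field; exact: lt0r_neq0.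
have -> : G x = 3 / A * (1 - 3^-1 * tphi x ^+ 2) / ((1 + tphi x ^+ 2) `^ (2 / 3)).
  by [].
have ct : tphi x ^+ 2 = c ^- 2 - 1 by rewrite -cu addrC addKr.
rewrite cu -/B ct.
by rewrite E; field; rewrite !lt0r_neq0.
Qed.

(** From [exp (-1/18) >= 17/18] one gets [exp (2/3) <= (18/17)^12], which is just below 2; the
    decimals bound the powers 2 and 4 on the way. *)
Lemma expR23_le2 : expR (2 / 3) <= 2 :> R.
Proof.
have h : expR (18^-1) <= 18 / 17 :> R.
  rewrite -[leLHS]invrK -expRN -[leRHS]invrK lef_pV2 ?posrE ?invr_gt0 ?expR_gt0//.
  have := expR_ge1Dx (- 18^-1 : R); lra.
have -> : 2 / 3 = 12%:R * 18^-1 :> R by field.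
rewrite expRM_natl (@le_trans _ _ ((18 / 17) ^+ 12))//.
  by rewrite lerXn2r ?nnegrE ?expR_ge0.
have h2 : (18 / 17) ^+ 2 <= 1122 / 1000 :> R by lra.
have h4 : (18 / 17) ^+ 4 <= 1259 / 1000 :> R.
  by rewrite (exprM _ 2 2); have := sqr_ge0 (18 / 17 : R); nra.
have h40 : 0 <= (18 / 17) ^+ 4 :> R by exact: exprn_ge0.
rewrite (exprM _ 4 3); nra.
Qed.

(* The difference is concave and nonnegative at both ends. *)
Lemma expR_le_cos_phi x : 0 <= x <= 3^-1 -> expR (2 * x) <= 2 * cos (phi x).
Proof.
have p0 := @pi_gt0 R.
move=> xI; rewrite -subr_ge0; move: x xI.
apply: (@nonincr_deriv_ge0 _ (fun x => 2 * cos (phi x) + - expR (2 * x))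
  (fun x => 2 * (pi * sin (phi x)) - 2 * expR (2 * x))).
- move=> x xI; apply: deriv_at_eq.
    apply: deriv_at_add; first apply: deriv_at_mul (deriv_cos_phi x).
      exact: deriv_at_cst.
    apply: deriv_at_opp; apply: (@deriv_at_comp _ expR (fun x => 2 * x)).
      exact: is_derive_expR.
    by deriv.
  by rewrite /=; ring.
- move=> x y x0 xy y1.
  have : sin (phi y) <= sin (phi x).
    have /phi_itv/andP[? ?] : 0 <= x <= 3^-1 by rewrite x0 (le_trans xy).
    have /phi_itv/andP[? ?] : 0 <= y <= 3^-1 by rewrite y1 (le_trans x0).
    rewrite leNgt ltr_sin ?in_itv/= -?leNgt; last 2 first.
    + by apply/andP; split; lra.
    + by apply/andP; split; lra.
    by rewrite lerD2l lerN2 ler_pM2l.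
  have : expR (2 * x) <= expR (2 * y) by rewrite ler_expR; lra.
  by move=> h1; rewrite -(ler_pM2l p0) => h2; lra.
- by rewrite phi0 cos_pi3 mulr0 expR0; lra.
- by rewrite phi13 cos0; have := expR23_le2; lra.
Qed.

(** On [0, 1/2] the difference [sin (pi y) - 2 y] is concave and vanishes at both ends; oddness does
    the rest. It turns a small sine into a small phase error. *)
Lemma jordan x : `|x| <= 2^-1 -> 2 * `|x| <= `|sin (pi * x)|.
Proof.
have p0 := @pi_gt0 R.
have pos y : 0 <= y <= 2^-1 -> 0 <= sin (pi * y) + - (2 * y).
  move: y; apply: (@nonincr_deriv_ge0 _ (fun y => sin (pi * y) + - (2 * y))
    (fun y => pi * cos (pi * y) - 2)).
  - move=> z _; apply: deriv_at_eq.
      apply: deriv_at_add; last by deriv.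
      apply: (@deriv_at_comp _ sin (fun y => pi * y)); last by deriv.
      exact: is_derive_sin.
    by rewrite /=; ring.
  - move=> u v u0 uv v1; rewrite lerD2r ler_pM2l//.
    have I (z : R) : 0 <= z -> z <= 2^-1 -> pi * z \in `[0, pi].
      move=> z0 z1; rewrite in_itv/= mulr_ge0 ?(ltW p0)//=.
      by rewrite ger_pMr//; lra.
    have Iu : pi * u \in `[0, pi] by apply: I => //; exact: le_trans v1.
    have Iv : pi * v \in `[0, pi] by apply: I => //; exact: le_trans uv.
    by rewrite leNgt ltr_cos// ltr_pM2l// -leNgt.
  - by rewrite !mulr0 sin0; lra.
  - by rewrite sin_pihalf; lra.
have [x0 xI|x0 xI] := ger0P x.
  have := pos x; rewrite x0 xI => /(_ isT) h.
  by rewrite ger0_norm; lra.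
have := pos (- x); rewrite mulrN sinN => h.
have {}h : 0 <= - sin (pi * x) + - (2 * - x) by apply: h; apply/andP; split; lra.
by rewrite ler0_norm; lra.
Qed.

End Values.

(** * The phase equation *)

Section Phase.
Variable R : realType.
Implicit Types (x y : R) (n : nat).

(* [tchi n x] is [chi (G x) n], up to the positive factors of [chi_tchi]. *)
Definition tchi n x : R :=
  2 * sin (n.+2%:R * phi x) + sin (n%:R * phi x)
  + 2 * sin (phi x) * cos (phi x) * (- (2 * cos (phi x))^-1) ^+ n.+2.

Lemma sin2M (f : R) : sin (2 * f) = 2 * cos f * sin f.
Proof. by rewrite mulr_natl sin_mulr2n -mulr_natl mulrA. Qed.

(** Imaginary part of [z^3 = G z^2 - 1] at [z = rho e^(i f)], rotated by [th], with [rho] eliminated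
    through [rho_cube] and [G_rho]. *)
Lemma sin_rec (th f : R) : 2 * cos f * sin (th + 3 * f) =
  (4 * cos f ^+ 2 - 1) * sin (th + 2 * f) - sin th.
Proof.
have -> : th + 3 * f = (th + 2 * f) + f by ring.
have -> : sin th = sin ((th + 2 * f) - f *+ 2) by congr (sin _); ring.
by rewrite sinD sinB cos_mulr2n sin_mulr2n; ring.
Qed.

Lemma tchi_rec n x : cos (phi x) != 0 -> 2 * cos (phi x) * tchi n.+3 x =
  (4 * cos (phi x) ^+ 2 - 1) * tchi n.+2 x - tchi n x.
Proof.
move=> c0; set c := cos _ in c0 *.
have S1 := sin_rec (n%:R * phi x) (phi x).
have S2 := sin_rec (n.+2%:R * phi x) (phi x).
rewrite /tchi -/c in S1 S2 *.
have E k l : k%:R * phi x + l%:R * phi x = (l + k)%:R * phi x :> R.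
  by rewrite -mulrDl -natrD addnC.
rewrite !E !add2n !add3n in S1 S2.
(* This is the third root [- rho^(-2)] divided by [rho], so its powers solve the same recurrence. *)
set e := - (2 * c)^-1.
have Ee : e ^+ n.+3.+2 * (2 * c) = e ^+ n.+4 * (4 * c ^+ 2 - 1) - e ^+ n.+2.
  by rewrite !(exprS e) /e; field; exact: c0.
transitivity (2 * (2 * c * sin (n.+3.+2%:R * phi x)) + 2 * c * sin (n.+3%:R * phi x)
    + 2 * sin (phi x) * c * (e ^+ n.+3.+2 * (2 * c))); first by ring.
by rewrite S1 S2 Ee; ring.
Qed.

(** Together with [tchi2], this is the recurrence with [tchi] read as 0 at negative indices, as for
    [chi]. *)
Lemma tchi1 x : cos (phi x) != 0 ->
  2 * cos (phi x) * tchi 1 x = (4 * cos (phi x) ^+ 2 - 1) * tchi 0 x.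
Proof.
move=> c0; rewrite /tchi mul0r sin0 mul1r.
have S1 := sin_rec 0 (phi x).
rewrite !add0r sin0 subr0 in S1; rewrite sin2M.
transitivity (2 * (2 * cos (phi x) * sin (3 * phi x)) + 2 * cos (phi x) * sin (phi x)
  + 2 * cos (phi x) * (2 * sin (phi x) * cos (phi x) * (- (2 * cos (phi x))^-1) ^+ 3)).
  by ring.
by rewrite S1 sin2M; field.
Qed.

Lemma tchi2 x : cos (phi x) != 0 ->
  2 * cos (phi x) * tchi 2 x = (4 * cos (phi x) ^+ 2 - 1) * tchi 1 x.
Proof.
move=> c0; rewrite /tchi mul1r.
have S1 := sin_rec (phi x) (phi x); have S2 := sin_rec (- phi x) (phi x).
have E3 : phi x + 2 * phi x = 3 * phi x by ring.
have E4 : phi x + 3 * phi x = 4 * phi x by ring.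
have E1 : - phi x + 2 * phi x = phi x by ring.
have E2 : - phi x + 3 * phi x = 2 * phi x by ring.
rewrite E3 E4 in S1; rewrite E1 E2 sinN in S2.
transitivity (2 * (2 * cos (phi x) * sin (4 * phi x)) + 2 * cos (phi x) * sin (2 * phi x)
  + 2 * cos (phi x) * (2 * sin (phi x) * cos (phi x) * (- (2 * cos (phi x))^-1) ^+ 4)).
  by ring.
by rewrite S1 S2; field.
Qed.

(** Multiplying by [rho^n] turns the recurrence of [tchi] into that of [chi (G x)]; the factor
    [tchi 0 x] matches the initial values. *)
Lemma chi_tchi n x : 0 <= x <= 3^-1 ->
  chi (G x) n * tchi 0 x = rho x ^+ n * tchi n x.
Proof.
move=> xI; have c0 := lt0r_neq0 (cos_phi_gt0 xI).
have r0 := lt0r_neq0 (rho_gt0 xI).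
have Gr := G_rho xI; have r3 := rho_cube xI.
elim/ltn_ind: n => -[|[|[|n]]] IH.
- by rewrite !mul1r.
- apply: (mulIf (expf_neq0 2 r0)).
  have -> : chi (G x) 1 = G x by [].
  have -> : rho x ^+ 1 * tchi 1 x * rho x ^+ 2 = rho x ^+ 3 * tchi 1 x by ring.
  by rewrite r3 tchi1// -Gr; ring.
- apply: (mulIf r0).
  have -> : rho x ^+ 2 * tchi 2 x * rho x = rho x ^+ 3 * tchi 2 x by ring.
  have := IH 1%N isT; have -> : chi (G x) 1 = G x by [].
  have -> : chi (G x) 2 = G x * G x by [].
  rewrite r3 tchi2// -Gr => h.
  by transitivity (G x * rho x * (G x * tchi 0 x)); [ring|rewrite h; ring].
- rewrite chi3 mulrBl -mulrA IH// IH; last by rewrite ltnW// ltnW.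
  have -> : rho x ^+ n.+3 * tchi n.+3 x = rho x ^+ n * (rho x ^+ 3 * tchi n.+3 x).
    by rewrite !exprS expr0; ring.
  by rewrite r3 tchi_rec// -Gr !exprS expr0; ring.
Qed.

Lemma tchi0_gt0 x : 0 < x < 3^-1 -> 0 < tchi 0 x.
Proof.
move=> xI; have s0 := sin_phi_gt0 xI.
have c0 : 0 < cos (phi x) by apply: cos_phi_gt0; case/andP: xI => *; rewrite !ltW.
rewrite /tchi mul0r sin0 addr0 sin2M.
have sc := mulr_gt0 s0 c0.
have := sqr_ge0 (- (2 * cos (phi x))^-1); set e := (X in 0 <= X) => e0.
by rewrite -(mulrA 2) [cos _ * _]mulrC; nra.
Qed.

Lemma tchi_eigenvalue n x : (0 < n)%N -> 0 < x < 3^-1 -> tchi n x = 0 ->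
  G x \in eigs R n.
Proof.
move=> n0 xI tx; have xI' : 0 <= x <= 3^-1 by case/andP: xI => *; rewrite !ltW.
rewrite mem_eigs eigenvalue_toepT//; apply/andP; split.
  have := chi_tchi n xI'; rewrite tx mulr0 => /eqP.
  by rewrite mulf_eq0 (gt_eqF (tchi0_gt0 xI)) orbF.
case/andP: xI => x0 x1; rewrite -(G0 R) -(G13 R).
by rewrite !G_incr// ltW.
Qed.

Definition Nshift n : R := n%:R + 3 / 2.
Definition Phase n x : R := Nshift n * x + vartheta x.

(** Expanding around [(n+1) f], the two sines become [3 cos f sin ((n+1) f) + sin f cos ((n+1) f)],
    a single sine shifted by [eta] with [tan eta = tan f / 3]: the arctangent in [vartheta]. The
    remaining term of [tchi], divided by the amplitude, is [e]. *)
Lemma tchi_phase n x : 0 <= x <= 3^-1 -> exists K e : R,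
  [/\ 0 < K, `|e| <= 2 / 3 * expR (- (2 * (Nshift n * x))) &
      tchi n x = K * (sin (pi * (Nshift n / 3 - Phase n x)) + e)].
Proof.
move=> xI; have c0 := cos_phi_gt0 xI; have p0 := @pi_gt0 R.
have s0 := sin_phi_ge0 xI.
pose eta := atan (tphi x / 3).
have ce : 0 < cos eta by rewrite cos_gt0_pihalf// atan_gtNpi2 atan_ltpi2.
exists (3 * cos (phi x) / cos eta).
exists (2 / 3 * sin (phi x) * cos eta * (- (2 * cos (phi x))^-1) ^+ n.+2).
split.
- by rewrite divr_gt0// mulr_gt0.
- rewrite -!mulrA normrM gtr0_norm// ler_pM2l// normrM gtr0_norm ?invr_gt0//.
  rewrite ler_pM2l ?invr_gt0// normrM -[leRHS]mul1r.
  rewrite ler_pM// ?sin_max// normrM -[leRHS]mul1r ler_pM// ?cos_max//.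
  rewrite normrX normrN normfV gtr0_norm ?mulr_gt0//.
  apply: (@le_trans _ _ (expR (- (2 * x)) ^+ n.+2)).
    rewrite lerXn2r ?nnegrE ?invr_ge0 ?expR_ge0 ?mulr_ge0 ?(ltW c0)//.
    by rewrite expRN lef_pV2 ?posrE ?mulr_gt0 ?expR_gt0// expR_le_cos_phi.
  (* The exponent [n + 2] exceeds [N = n + 3/2]. *)
  rewrite -expRM_natl ler_expR mulrN lerN2.
  case/andP: xI => x0 _; rewrite /Nshift -[n.+2%:R]natr1 -[n.+1%:R]natr1; nra.
have -> : pi * (Nshift n / 3 - Phase n x) = n.+1%:R * phi x + eta.
  rewrite /Phase /vartheta -/(phi x) -/(tphi x) -/eta /Nshift /phi -natr1.
  by move: p0; generalize (pi : R) => p p0; field; exact: lt0r_neq0.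
have te : sin eta = cos eta * (tphi x / 3).
  by rewrite -[X in _ = _ * X]atanK -/eta /tan mulrC divfK// lt0r_neq0.
rewrite sinD te /tphi /tan /tchi.
have -> : n.+2%:R * phi x = n.+1%:R * phi x + phi x by rewrite -[n.+2%:R]natr1; ring.
have -> : n%:R * phi x = n.+1%:R * phi x - phi x by rewrite -[n.+1%:R]natr1; ring.
rewrite sinD (sinB (n.+1%:R * _)); set e := _ ^+ n.+2.
by field; rewrite !lt0r_neq0.
Qed.

Lemma tchi_continuous n : {within `[0, 3^-1], continuous (tchi n)}.
Proof.
apply: deriv_within_continuous => x xI; eexists.
have c0 := lt0r_neq0 (cos_phi_gt0 xI).
have Ds (k : R) : deriv_at (fun y => sin (k * phi y)) x
    (cos (k * phi x) * (k * - pi + phi x * 0)).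
  apply: (@deriv_at_comp _ sin (fun y => k * phi y)); first exact: is_derive_sin.
  exact: deriv_at_mul (deriv_at_cst k x) (deriv_phi x).
apply: deriv_at_add.
  by apply: deriv_at_add; [apply: deriv_at_mul; [exact: deriv_at_cst|exact: Ds]|exact: Ds].
apply: deriv_at_mul.
  apply: deriv_at_mul (deriv_cos_phi x).
  exact: deriv_at_mul (deriv_at_cst 2 x) (deriv_sin_phi x).
apply: deriv_at_exp; apply: deriv_at_opp.
apply: (@deriv_at_inv _ (fun y => 2 * cos (phi y))); first by rewrite mulf_neq0.
exact: deriv_at_mul (deriv_at_cst 2 x) (deriv_cos_phi x).
Qed.

Lemma Nshift_ge1 n : 1 <= Nshift n.
Proof. by rewrite /Nshift; have := ler0n R n; lra. Qed.

Lemma deriv_Phase n x : 0 <= x <= 3^-1 ->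
  deriv_at (Phase n) x (Nshift n + vt1 x).
Proof.
move=> xI; apply: deriv_at_eq.
  apply: deriv_at_add; first by deriv.
  exact/deriv_vartheta/lt0r_neq0/cos_phi_gt0.
by rewrite /=; ring.
Qed.

(** The slope [N >= 1] dominates [|vartheta'| <= 1/2]. *)
Lemma Phase_incr n x y : 0 <= x -> x < y -> y <= 3^-1 -> Phase n x < Phase n y.
Proof.
apply: (@deriv_gt0_incr _ _ (fun x => Nshift n + vt1 x)) => z zI.
  exact: deriv_Phase.
have zI' : 0 <= z <= 3^-1 by case/andP: zI => *; rewrite !ltW.
have := vt1_bound zI'; rewrite ler_norml => /andP[h _].
by have := Nshift_ge1 n; lra.
Qed.

Lemma Phase_lt n x y : 0 <= x <= 3^-1 -> 0 <= y <= 3^-1 ->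
  (Phase n x < Phase n y) = (x < y).
Proof.
move=> /andP[x0 x1] /andP[y0 y1]; have [xy|yx|->] := ltgtP x y.
- by rewrite Phase_incr.
- by apply/negbTE; rewrite -leNgt ltW// Phase_incr.
- by rewrite ltxx.
Qed.

Lemma Phase_onto n v : 0 <= v <= Nshift n / 3 ->
  exists2 x, 0 <= x <= 3^-1 & Phase n x = v.
Proof.
move=> /andP[v0 v1].
have P0 : Phase n 0 = 0 by rewrite /Phase mulr0 vartheta0 addr0.
have P1 : Phase n 3^-1 = Nshift n / 3 by rewrite /Phase vartheta13 addr0.
have [|||x xI E] := @IVT R (Phase n) 0 3^-1 v.
- by rewrite invr_ge0.
- by apply: deriv_within_continuous => x xI; eexists; exact: deriv_Phase xI.
- by rewrite P0 P1 ge_min le_max v0 v1 orbT.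
- by exists x => //; move: xI; rewrite in_itv.
Qed.

End Phase.

(** * Localisation of the eigenvalues and expansion *)

Section Roots.
Variable R : realType.
Implicit Types (x y : R) (n : nat).

Lemma sin_natDpi k x : sin (pi * k%:R + x) = (-1) ^+ k * sin x.
Proof.
elim: k => [|k IH]; first by rewrite mulr0 add0r mul1r.
have -> : pi * k.+1%:R + x = pi * k%:R + x + pi by rewrite -natr1; ring.
by rewrite sinDpi IH exprS; ring.
Qed.

Lemma Nshift_third n :
  Nshift R n / 3 = (n %/ 3)%:R + (n %% 3)%:R / 3 + 2^-1.
Proof.
rewrite /Nshift [in LHS](divn_eq n 3) natrD natrM.
by move: (_ %/ _)%:R (_ %% _)%:R => a b; field.
Qed.

(* Where the phase is [r/3 + i], the sine in [tchi_phase] is [+-1]. *)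
Lemma tchi_sign n i x : (i <= n %/ 3)%N -> 0 <= x <= 3^-1 ->
  Phase n x = (n %% 3)%:R / 3 + i%:R -> 0 < (-1) ^+ (n %/ 3 - i) * tchi n x.
Proof.
move=> im xI Px; have [K [e [K0 eb ->]]] := tchi_phase n xI.
rewrite Px Nshift_third; set r := _ / 3.
have -> : pi * ((n %/ 3)%:R + r + 2^-1 - (r + i%:R)) =
    pi * (n %/ 3 - i)%:R + pi / 2 :> R.
  by rewrite natrB//; ring.
rewrite sin_natDpi sin_pihalf mulr1.
(* The correction is at most 2/3 in size, so it cannot change the sign given by the sine. *)
have {eb}eb : `|e| < 1.
  apply: le_lt_trans eb _; have : expR (- (2 * (Nshift R n * x))) <= 1.
    rewrite expR_le1 oppr_le0 !mulr_ge0//; first by have := Nshift_ge1 R n; lra.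
    by case/andP: xI.
  lra.
rewrite mulrCA mulr_gt0// mulrDr -expr2 sqrr_sign.
have : `|(-1) ^+ (n %/ 3 - i) * e| < 1 by rewrite normrM normr_sign mul1r.
by rewrite ltr_norml => /andP[? _]; lra.
Qed.

Lemma tchi_root n j : (j < n %/ 3)%N -> exists x,
  [/\ 0 < x < 3^-1, tchi n x = 0 &
   (n %% 3)%:R / 3 + j%:R < Phase n x < (n %% 3)%:R / 3 + j.+1%:R].
Proof.
move=> jm; set r : R := (n %% 3)%:R / 3.
have r0 : 0 <= r by rewrite divr_ge0.
have NE := Nshift_third n; rewrite -/r in NE.
have jm' : j.+1%:R <= (n %/ 3)%:R :> R by rewrite ler_nat.
have j0 := ler0n R j; have jS : j%:R + 1 = j.+1%:R :> R := natr1 _.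
have [|a aI Pa] := @Phase_onto R n (r + j%:R).
  by rewrite NE; apply/andP; split; lra.
have [|b bI Pb] := @Phase_onto R n (r + j.+1%:R).
  by rewrite NE; apply/andP; split; lra.
have ab : a < b by rewrite -(Phase_lt n aI bI) Pa Pb; lra.
have Sa := tchi_sign (ltnW jm) aI Pa; have Sb := tchi_sign jm bI Pb.
have [a0 _] := andP aI; have [_ b1] := andP bI.
(* The sign exponents at [a] and [b] differ by one, so [tchi] changes sign. *)
rewrite -(subnSK jm) exprS mulN1r mulNr in Sa.
have [|||x + Sx] := @IVT R (tchi n) a b 0; first exact: ltW.
- apply: continuous_subspaceW (@tchi_continuous R n) => z /=.
  rewrite !in_itv/= => /andP[az zb].
  by rewrite (le_trans a0)//= (le_trans zb).
- move: Sa Sb; rewrite -signr_odd; case: (odd _); rewrite ?expr0 ?expr1 => h1 h2;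
    rewrite ge_min le_max; apply/andP; split; apply/orP.
  + by right; lra.
  + by left; lra.
  + by left; lra.
  + by right; lra.
rewrite in_itv/= => /andP[ax xb].
have {}ax : a < x.
  rewrite lt_neqAle ax andbT; apply: contraTneq Sa => ->.
  by rewrite Sx mulr0 oppr0 ltxx.
have {}xb : x < b.
  rewrite lt_neqAle xb andbT; apply: contraTneq Sb => <-.
  by rewrite Sx mulr0 ltxx.
exists x; split=> //.
  by rewrite (le_lt_trans a0)// (lt_le_trans xb).
by rewrite -Pa -Pb !Phase_incr// ltW// ?(le_lt_trans a0)// ?(lt_le_trans xb).
Qed.

(** For the index [j.+1] this is the midpoint of the phase interval in [tchi_root]. *)
Lemma phase_sigma n j : Nshift R n * sigma R n j = j%:R - 2^-1 + (n %% 3)%:R / 3.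
Proof.
by rewrite /sigma mulrC divfK// gt_eqF.
Qed.

(** The distance [y] to the midpoint is at most 1/2 and satisfies [|sin (pi y)| = |e|], so [jordan]
    bounds it by [|e| / 2]. *)
Lemma tchi_root_phase n j x : (j < n %/ 3)%N -> 0 < x < 3^-1 -> tchi n x = 0 ->
  (n %% 3)%:R / 3 + j%:R < Phase n x < (n %% 3)%:R / 3 + j.+1%:R ->
  `|Phase n x - Nshift R n * sigma R n j.+1| <= expR (2 - 2 * j%:R).
Proof.
move=> jm /andP[x0 x1] Sx /andP[Pl Pr].
have xI : 0 <= x <= 3^-1 by rewrite !ltW.
have [K [e [K0 eb]]] := tchi_phase n xI; rewrite Sx => /esym/eqP.
rewrite mulf_eq0 gt_eqF//= addr_eq0 => /eqP se.
rewrite phase_sigma; set r := _ / 3 in Pl Pr *.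
have jS : j%:R + 1 = j.+1%:R :> R := natr1 _.
set y := Phase n x - _.
have yI : `|y| <= 2^-1 by rewrite ler_norml /y; apply/andP; split; lra.
have ye : `|sin (pi * y)| = `|e|.
  rewrite -[RHS]normrN -se Nshift_third -/r.
  have -> : pi * ((n %/ 3)%:R + r + 2^-1 - Phase n x) =
      pi * (n %/ 3 - j)%:R + - (pi * y).
    by rewrite natrB 1?ltnW// /y -jS; field.
  by rewrite sin_natDpi sinN normrM normr_sign mul1r normrN.
have := jordan yI; rewrite ye => h.
(* The phase exceeds [j] and [vartheta <= 1], hence [N x > j - 1]. *)
have e1 : expR (- (2 * (Nshift R n * x))) <= expR (2 - 2 * j%:R).
  rewrite ler_expR; have := vartheta_bound xI; rewrite ler_norml => /andP[_].
  have : 0 <= r by rewrite divr_ge0.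
  by move: Pl; rewrite /Phase; lra.
have := expR_ge0 (2 - 2 * j%:R : R); lra.
Qed.

(** The points of [tchi_root] give [n %/ 3] increasing values in [eigs], which by [size_eigs] has no
    room for more; the two sorted lists coincide. *)
Lemma lambda_root n : exists x : nat -> R, forall j, (j < n %/ 3)%N ->
  [/\ 0 <= x j <= 3^-1, lambda R n j.+1 = G (x j) &
      `|Phase n (x j) - Nshift R n * sigma R n j.+1| <= expR (2 - 2 * j%:R)].
Proof.
have [n0|n0] := posnP (n %/ 3); first by exists (fun=> 0) => j; rewrite n0.
have npos : (0 < n)%N by case: (n) n0.
have /choice[x xP] : forall j, exists x, (j < n %/ 3)%N ->
    [/\ 0 < x < 3^-1, tchi n x = 0 &
     (n %% 3)%:R / 3 + j%:R < Phase n x < (n %% 3)%:R / 3 + j.+1%:R].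
  move=> j; have [jm|jm] := boolP (j < n %/ 3)%N; last by exists 0.
  by have [x ?] := tchi_root jm; exists x.
have xI j : (j < n %/ 3)%N -> 0 <= x j <= 3^-1.
  by move=> /xP[/andP[? ?] _ _]; rewrite !ltW.
have eigsE : eigs R n = mkseq (fun j => G (x j)) (n %/ 3).
  have srt : sorted <%R (mkseq (fun j => G (x j)) (n %/ 3)).
    apply/(sortedP 0) => i; rewrite size_mkseq => im.
    rewrite !nth_mkseq//; last exact: ltnW.
    have im' := ltnW im.
    have [x0 _] := andP (xI _ im'); have [_ x1] := andP (xI _ im).
    apply: G_incr => //; rewrite -(Phase_lt n (xI _ im') (xI _ im)).
    have [_ _ /andP[_ h]] := xP _ im'; have [_ _ /andP[h' _]] := xP _ im.
    exact: lt_trans h h'.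
  apply: (lt_sorted_eq (sorted_eigs R n) srt) => z.
  have [||_ ->//] := uniq_min_size (lt_sorted_uniq srt) (s2 := eigs R n).
    move=> y /mapP[j]; rewrite mem_iota/= add0n => jm ->.
    by have [h1 h2 _] := xP _ jm; apply: tchi_eigenvalue.
  by rewrite size_mkseq size_eigs.
exists x => j jm; have [h1 h2 h3] := xP _ jm; split.
- exact: xI.
- by rewrite /lambda eigsE nth_mkseq.
- exact: tchi_root_phase.
Qed.

Lemma sigma_itv n j : (0 < j <= n %/ 3)%N -> 0 <= sigma R n j <= 3^-1.
Proof.
move=> /andP[j0 jm]; have N1 := Nshift_ge1 R n.
have N0 : 0 < Nshift R n by lra.
rewrite -(ler_pM2l N0) -[X in _ && X](ler_pM2l N0) mulr0 phase_sigma Nshift_third.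
have : 1 <= j%:R :> R by rewrite ler1n.
have : j%:R <= (n %/ 3)%:R :> R by rewrite ler_nat.
have : 0 <= (n %% 3)%:R / 3 :> R by rewrite divr_ge0.
by move=> ? ? ?; apply/andP; split; lra.
Qed.

(** * Expansion of [G] along the perturbed phase equation *)

Lemma normM_le (a b A B : R) : `|a| <= A -> `|b| <= B -> `|a * b| <= A * B.
Proof. by move=> aA bB; rewrite normrM ler_pM. Qed.

Lemma normD_le (a b A B : R) : `|a| <= A -> `|b| <= B -> `|a + b| <= A + B.
Proof. by move=> aA bB; rewrite (le_trans (ler_normD _ _))// lerD. Qed.

(** Here [h] is [1/N]. Substituting the implicit equation for [u = a - s] into itself twice gives [u
    = - h vartheta + h^2 vartheta vartheta' + O(h^3)] at [s], which is inserted into the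
    second-order Taylor expansion of [G]. *)
Lemma G_expansion (C0 : R) : exists2 C : R, 0 < C & forall (h s a y : R),
  0 < h <= 1 -> 0 <= s <= 3^-1 -> 0 <= a <= 3^-1 -> `|y| <= C0 * h ^+ 2 ->
  a = s + h * (y - vartheta a) ->
  `|G a - (A0 s + A1 s * h + A2 s * h ^+ 2)| <= C * h ^+ 3.
Proof.
have [M M0 HM] := G_bounds R.
have p0 := @pi_gt0 R.
pose M2 : R := 48 * pi * 8.
have M20 : 0 <= M2 by rewrite /M2 !mulr_ge0// ltW.
(* [B], [D1] and [D] will bound [u / h], [d1 / h^2] and [d / h^3], where [d1] and [d] are the errors
   after the first and second substitution. *)
pose c := `|C0|; have c0 : 0 <= c by exact: normr_ge0.
pose B := c + 1; pose D1 := c + 2^-1 * B + M2 * B ^+ 2.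
pose D := c + M2 * B ^+ 2 + 2^-1 * D1.
have B0 : 0 <= B by rewrite /B; lra.
have B20 : 0 <= M2 * B ^+ 2 by rewrite mulr_ge0// exprn_ge0.
have B30 : 0 <= B ^+ 3 by rewrite exprn_ge0.
have D10 : 0 <= D1 by rewrite /D1; lra.
have D0 : 0 <= D by rewrite /D; lra.
have DB : 0 <= D1 * (B + 1) by rewrite mulr_ge0//; lra.
exists (M * (B ^+ 3 + D + 2^-1 * (D1 * (B + 1)) + 1)).
  by rewrite mulr_gt0//; lra.
move=> h s a y /andP[h0 h1] sI aI yb aE.
have h0' := ltW h0; have h20 : 0 <= h ^+ 2 by exact: exprn_ge0.
have h30 : 0 <= h ^+ 3 by exact: exprn_ge0.
have hh : h ^+ 2 <= 1 by rewrite expr_le1.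
have {}yb : `|y| <= c * h ^+ 2.
  by rewrite (le_trans yb)// ler_wpM2r// ler_norm.
have yc : `|y| <= c by rewrite (le_trans yb)// ler_piMr.
have nh : `|h| <= h by rewrite ger0_norm.
have [G1b G2b _] := HM s sI.
pose u := a - s; have uE : u = h * (y - vartheta a) by rewrite /u {1}aE addrAC subrr add0r.
have ub : `|u| <= h * B.
  rewrite uE; apply: normM_le => //; apply: normD_le => //.
  by rewrite normrN vartheta_bound.
pose e1 := vartheta a - vartheta s - vt1 s * u.
have e1b : `|e1| <= M2 * B ^+ 2 * h ^+ 2.
  have dv z : 0 <= z <= 3^-1 -> deriv_at (@vartheta R) z (vt1 z).
    by move=> zI; exact/deriv_vartheta/lt0r_neq0/cos_phi_gt0.
  have dv1 z : 0 <= z <= 3^-1 -> deriv_at (@vt1 R) z (vt2 z).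
    by move=> zI; exact/deriv_vt1/lt0r_neq0/cos_phi_gt0.
  apply: le_trans (taylor1 dv dv1 (@vt2_bound R) sI aI) _.
  rewrite -[leRHS]mulrA ler_wpM2l// -exprMn lerXn2r ?nnegrE ?mulr_ge0//.
  by rewrite mulrC.
pose e3 := G a - G s - G1 s * u - 2^-1 * G2 s * u ^+ 2.
have e3b : `|e3| <= M * B ^+ 3 * h ^+ 3.
  have dG z : 0 <= z <= 3^-1 -> deriv_at (@G R) z (G1 z).
    by move=> zI; exact/deriv_G/lt0r_neq0/cos_phi_gt0.
  have dG1 z : 0 <= z <= 3^-1 -> deriv_at (@G1 R) z (G2 z).
    by move=> zI; exact/deriv_G1/lt0r_neq0/cos_phi_gt0.
  have dG2 z : 0 <= z <= 3^-1 -> deriv_at (@G2 R) z (G3 z).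
    by move=> zI; exact/deriv_G2/lt0r_neq0/cos_phi_gt0.
  have G3b z : 0 <= z <= 3^-1 -> `|G3 z| <= M by move=> /HM[].
  apply: le_trans (taylor2 dG dG1 dG2 G3b sI aI) _.
  rewrite -mulrA ler_wpM2l ?(ltW M0)// -exprMn lerXn2r ?nnegrE ?mulr_ge0//.
  by rewrite mulrC.
have v1b := vt1_bound sI; have vb := vartheta_bound sI.
(* First substitution: [vartheta a] is replaced by its expansion at [s]. *)
pose d1 := h * (y - vt1 s * u - e1).
have u1 : u = - h * vartheta s + d1 by rewrite /d1 /e1 {1}uE; ring.
have d1b : `|d1| <= h ^+ 2 * D1.
  have -> : h ^+ 2 * D1 = h * (c * h + 2^-1 * (h * B) + M2 * B ^+ 2 * h).
    by rewrite /D1; ring.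
  have hh2 : h ^+ 2 <= h by rewrite expr2 ler_piMl.
  apply: normM_le => //; apply: normD_le; first apply: normD_le.
  - by rewrite (le_trans yb)// ler_wpM2l.
  - by rewrite normrN; apply: normM_le.
  - by rewrite normrN (le_trans e1b)// ler_wpM2l.
(* Second substitution: the [u] inside [d1] is replaced by [- h vartheta s + d1], which isolates the
   [h^2] term. *)
pose d := h * (y - e1 - vt1 s * d1).
have u2 : u = - h * vartheta s + h ^+ 2 * (vt1 s * vartheta s) + d.
  by rewrite /d {1}u1 {1}/d1 {1}u1; ring.
have db : `|d| <= D * h ^+ 3.
  have -> : D * h ^+ 3 = h * (c * h ^+ 2 + M2 * B ^+ 2 * h ^+ 2 + 2^-1 * (h ^+ 2 * D1)).
    by rewrite /D; ring.
  apply: normM_le => //; apply: normD_le; first by apply: normD_le; rewrite ?normrN.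
  by rewrite normrN; apply: normM_le.
(* Difference of squares, with [d1 = u + h vartheta s] as one factor. *)
pose d2 := d1 * (u + - (h * vartheta s)).
have u3 : u ^+ 2 = h ^+ 2 * vartheta s ^+ 2 + d2.
  by rewrite /d2 {1 2}u1; ring.
have d2b : `|d2| <= D1 * (B + 1) * h ^+ 3.
  have -> : D1 * (B + 1) * h ^+ 3 = h ^+ 2 * D1 * (h * B + h * 1) by ring.
  apply: normM_le => //; apply: normD_le => //.
  by rewrite normrN; apply: normM_le.
rewrite /A0 /A1 /A2 derive1_G// derive1n2_G// derive1_vartheta//.
have -> : G a - (G s + - G1 s * vartheta s * h +
    (G1 s * vartheta s * vt1 s + 2^-1 * G2 s * vartheta s ^+ 2) * h ^+ 2) =
    e3 + G1 s * d + 2^-1 * (G2 s * d2).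
  have -> : d2 = u ^+ 2 - h ^+ 2 * vartheta s ^+ 2 by rewrite u3; ring.
  have -> : d = u + h * vartheta s - h ^+ 2 * (vt1 s * vartheta s).
    by rewrite u2; ring.
  by rewrite /e3; ring.
have -> : M * (B ^+ 3 + D + 2^-1 * (D1 * (B + 1)) + 1) * h ^+ 3 =
   M * B ^+ 3 * h ^+ 3 + M * (D * h ^+ 3) + 2^-1 * (M * (D1 * (B + 1) * h ^+ 3)) + M * h ^+ 3.
  by ring.
rewrite ler_wpDr ?mulr_ge0 ?(ltW M0)//.
apply: normD_le; first by apply: normD_le => //; apply: normM_le.
by apply: normM_le; [rewrite ger0_norm|apply: normM_le].
Qed.

End Roots.
Unset Implicit Arguments.

Theorem theorem1p4 (R : realType) :
  exists C1 : R, 0 < C1 /\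
  exists n0 : nat, forall n : nat, (3 <= n)%N -> (n0 <= n)%N ->
  forall j : nat, Num.floor (ln (n%:R : R)) <= j%:Z -> (j <= n %/ 3)%N ->
  exists R1 : R,
    lambda R n j =
      A0 (sigma R n j)
      + A1 (sigma R n j) / (n%:R + 3 / 2)
      + A2 (sigma R n j) / (n%:R + 3 / 2) ^+ 2
      + R1
    /\ `|R1| <= C1 / (n%:R + 3 / 2) ^+ 3.
Proof.
(* Since [ln n < j + 1], the phase error [exp (2 - 2 (j - 1))] is at most [exp 6 / n^2]; the factor
   4 comes from [N <= 2 n]. *)
have [C C0 HC] := @G_expansion R (4 * expR 6).
exists C; split=> //; exists 0%N => n n3 _ j jn jm.
rewrite -/(Nshift R n).
have N1 := Nshift_ge1 R n; have N0 : 0 < Nshift R n by lra.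
have n3R : 3 <= n%:R :> R by rewrite ler_nat.
have lnj : ln (n%:R : R) < j%:R + 1.
  have := floorD1_gt (ln (n%:R : R)) => /lt_le_trans; apply.
  by rewrite intrD lerD2r -[j%:R]/(j%:Z%:~R) ler_int.
have n0 : 0 < n%:R :> R by lra.
(* As [n >= 3 >= e], the floor of the logarithm excludes [j = 0], where [lambda] would read a
   default index. The bound on [e] comes from [e^2 = exp (2/3)^3 <= 8]. *)
have j0 : (0 < j)%N.
  have e3 : expR 1 <= 3 :> R.
    have : expR 1 ^+ 2 = expR (2 / 3) ^+ 3 :> R.
      by rewrite -!expRM_natl; congr expR; field.
    have : expR (2 / 3) ^+ 3 <= 2 ^+ 3 :> R.
      by rewrite lerXn2r ?nnegrE ?expR_ge0 ?expR23_le2.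
    by have := expR_gt0 (1 : R); nra.
  rewrite lt0n; apply: contraTneq lnj => ->.
  by rewrite add0r -leNgt -ler_expR lnK ?posrE// (le_trans e3).
case: j => // j in j0 jn jm lnj *.
have [x xP] := lambda_root R n; have [xI -> Pb] := xP j jm.
set s := sigma R n j.+1 in Pb *.
exists (G (x j) - (A0 s + A1 s / Nshift R n + A2 s / Nshift R n ^+ 2)).
split; first by ring.
rewrite -!exprVn.
(* With [h = 1/N] and [y] the phase error, the implicit equation is the definition of [Phase] solved
   for [x j]. *)
apply: (HC _ _ _ (Phase n (x j) - Nshift R n * s)) => //.
- by rewrite invr_gt0 N0 invf_le1.
- by apply: sigma_itv; rewrite j0.
- apply: le_trans Pb _.
  have e0 := expR_gt0 (6 : R).
  have : expR (2 - 2 * j%:R) <= expR 6 / n%:R ^+ 2 :> R.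
    rewrite -[n%:R]lnK ?posrE// -expRM_natl -expRB ler_expR.
    by move: lnj; rewrite -natr1; lra.
  move=> /le_trans; apply.
  rewrite -[4 * _]mulrC -mulrA ler_pM2l// exprVn.
  rewrite -[leLHS]mul1r ler_pdivrMr ?exprn_gt0// mulrAC ler_pdivlMr ?exprn_gt0// mul1r.
  by rewrite /Nshift; nra.
rewrite /Phase; field; exact: lt0r_neq0.
Qed.
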